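(* There is a polynomial-time algorithm (polynomial in the number of vertices and in the binary encoding size of the weights) that, given an arena $\mathcal{A} = (V, V_0, V_1, E, v_I)$ and a weight function $w \colon E \to -\mathbb{N} \cup \{\mathrm{R}\}$, decides whether there exists a capacity $cap \in \mathbb{N}$ such that Player~$0$ wins $(\mathcal{A}, \mathsf{Recharge}(w, cap))$.
   Context: An arena $\mathcal{A} = (V, V_0, V_1, E, v_I)$ consists of a finite directed graph $(V,E)$ in which every vertex has at least one outgoing edge, a partition $V = V_0 \uplus V_1$, and an initial vertex $v_I$. A play is an infinite path $v_0 v_1 \cdots$ with $v_0 = v_I$. A strategy for Player~$i$ is a map $\sigma \colon V^* V_i \to V$ with $(v, \sigma(xv)) \in E$; a play is consistent with $\sigma$ if $v_{n+1} = \sigma(v_0\cdots v_n)$ whenever $v_n \in V_i$. Player~$0$ wins $(\mathcal{A}, \mathrm{Win})$ for $\mathrm{Win} \subseteq V^\omega$ if she has a strategy all of whose consistent plays lie in $\mathrm{Win}$. A recharge weight function $w \colon E \to -\mathbb{N} \cup \{\mathrm{R}\}$ labels each edge with a non-positive integer or the recharge action $\mathrm{R}$. For a finite path $x$ without $\mathrm{R}$-edges, $\mathrm{EL}(x)$ is the sum of its edge weights. $\mathrm{EL}_{cap}(v_0\cdots v_n) = cap + \mathrm{EL}(x)$ where $x$ is the longest suffix of $v_0\cdots v_n$ containing no $\mathrm{R}$-edge (so a play starts with energy $cap$). $\mathsf{Recharge}(w,cap) = \{v_0 v_1 \cdots \mid \forall n.\ \mathrm{EL}_{cap}(v_0\cdots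 v_n) \ge 0\}$. *)

(* Defs.v *)
From mathcomp Require Import all_boot all_order all_algebra.
Set Implicit Arguments. Unset Strict Implicit. Unset Printing Implicit Defensive.
Import Order.TTheory GRing.Theory Num.Theory.

(* Arenas with vertex set V = 'I_n (any finite vertex set is in bijection
   with some 'I_n).  V1 is the complement of V0.                       *)
Record arena (n : nat) := Arena {
  V0 : {set 'I_n};
  edge : rel 'I_n;
  vI : 'I_n }.

Definition arena_ok n (A : arena n) := forall v, exists u, edge A v u.

(* recharge weight function: [Some k] is the weight -k, [None] is R.
   Only its values on edges are relevant. *)
Definition rweight n := 'I_n -> 'I_n -> option nat.

Section Game.
Variables (n : nat) (A : arena n).

Definition play (p : nat -> 'I_n) := p 0 = vI A /\ forall k, edge A (p k) (p k.+1).

Definition prefix (p : nat -> 'I_n) k := [seq p i | i <- iota 0 k].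

Definition strategy0 (sigma : seq 'I_n -> 'I_n -> 'I_n) :=
  forall x v, v \in V0 A -> edge A v (sigma x v).

Definition consistent (sigma : seq 'I_n -> 'I_n -> 'I_n) (p : nat -> 'I_n) :=
  forall k, p k \in V0 A -> p k.+1 = sigma (prefix p k) (p k).

Definition wins0 (Win : (nat -> 'I_n) -> Prop) :=
  exists sigma, strategy0 sigma /\
    forall p, play p -> consistent sigma p -> Win p.

(* EL_cap(v_0 ... v_k) = cap + EL(longest R-free suffix) *)
Fixpoint ELcap (w : rweight n) (cap : nat) (p : nat -> 'I_n) (k : nat) : int :=
  match k with
  | 0 => cap%:Z
  | k'.+1 => match w (p k') (p k) with
             | None => cap%:Z
             | Some c => (ELcap w cap p k' - c%:Z)%R
             end
  end.

Definition Recharge (w : rweight n) (cap : nat) (p : nat -> 'I_n) :=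
  forall k, (0 <= ELcap w cap p k)%R.

End Game.

(* Model of computation: unit-cost RAM with addition, truncated
   subtraction and indirect addressing (polynomially equivalent to
   Turing machines).                                                  *)
Inductive instr :=
| IConst (r c : nat)
| IAdd (r a b : nat)
| ISub (r a b : nat)
| ILoad (r a : nat)
| IStore (a b : nat)
| IJz (r l : nat)
| IJmp (l : nat)
| IHalt.

Definition upd (m : nat -> nat) (r x : nat) : nat -> nat :=
  fun a => if a == r then x else m a.

(* [exec prog t pc m = Some m'] : started at pc with memory m, the
   program halts within t steps (an instruction is a step) with memory
   m'.  A pc outside the program acts as Halt. *)
Fixpoint exec (prog : seq instr) (t pc : nat) (m : nat -> nat)
  : option (nat -> nat) :=
  match t with
  | 0 => None
  | t'.+1 =>
    match nth IHalt prog pc with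
    | IHalt => Some m
    | IConst r c => exec prog t' pc.+1 (upd m r c)
    | IAdd r a b => exec prog t' pc.+1 (upd m r (m a + m b))
    | ISub r a b => exec prog t' pc.+1 (upd m r (m a - m b))
    | ILoad r a => exec prog t' pc.+1 (upd m r (m (m a)))
    | IStore a b => exec prog t' pc.+1 (upd m (m a) (m b))
    | IJz r l => if m r == 0 then exec prog t' l m else exec prog t' pc.+1 m
    | IJmp l => exec prog t' l m
    end
  end.

Definition init_mem (s : seq nat) : nat -> nat :=
  fun a => if a == 0 then size s else nth 0 s a.-1.

Definition edge_list n (A : arena n) : seq ('I_n * 'I_n) :=
  enum [pred e : 'I_n * 'I_n | edge A e.1 e.2].

Definition encode n (A : arena n) (w : rweight n) : seq nat :=
  [:: n; val (vI A)]
  ++ [seq nat_of_bool (i \notin V0 A) | i <- enum 'I_n]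
  ++ [:: size (edge_list A)]
  ++ flatten [seq [:: val e.1; val e.2;
                      (if w e.1 e.2 is Some _ then 0 else 1);
                      (if w e.1 e.2 is Some c then c else 0)]
             | e <- edge_list A].

Definition bitlen (k : nat) := (trunc_log 2 k).+1.

Definition input_size n (A : arena n) (w : rweight n) : nat :=
  n + \sum_(e <- edge_list A)
        (if w e.1 e.2 is Some c then bitlen c else 1).

(* Main.v *)
Require Import Defs.
From mathcomp Require Import all_boot all_order all_algebra.
From mathcomp Require Import zify.

(* Whether some capacity suffices depends only on which weights are zero, so
   every nonzero weight may be replaced by -1.  Let T be a number of energy
   levels, T itself meaning "not winnable"; the least energy from which Player 0
   wins is the least fixpoint of a Bellman operator (a recharge edge costs
   nothing if its target is winnable), reached from 0 after n * T rounds.  If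
   Player 0 wins with capacity cap, the Bellman iterates for T = cap + 1 stay
   below the energy along all plays consistent with her strategy.  Replacing each
   winnable value by the number of vertices with a smaller value keeps it
   Bellman-closed, so T = n levels always suffice: n * n rounds decide the
   question.  *)

Set Implicit Arguments. Unset Strict Implicit. Unset Printing Implicit Defensive.
Import Order.TTheory GRing.Theory Num.Theory.

(** * The Bellman operator of the unit-weight game *)

(* Energy needed to take an edge of weight o to a vertex that needs x. *)
Definition cost (T : nat) (o : option nat) (x : nat) : nat :=
  match o with
  | None => if x < T then 0 else T
  | Some 0 => x
  | Some _.+1 => minn x.+1 T
  end.

Lemma cost_mono T o x y : x <= y -> cost T o x <= cost T o y.
Proof. case: o => [[|c]|] /=; try lia. by case: ltnP; case: ltnP; lia. Qed.

Lemma cost_le_top T o x : x <= T -> cost T o x <= T.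
Proof. case: o => [[|c]|] /=; try lia. by case: ltnP; lia. Qed.

Section Bellman.
Variables (n : nat) (A : arena n) (w : rweight n) (T : nat).

(** The operator is a fold over single edges, started from the neutral values [T] of min and 0 of
    max, so that each [relax] is one pass of the edge loop of the program. *)
Definition relax (f : 'I_n -> nat) (e : 'I_n * 'I_n) (g : 'I_n -> nat) v :=
  let c := cost T (w e.1 e.2) (f e.2) in
  if v == e.1 then (if v \in V0 A then minn (g v) c else maxn (g v) c)
  else g v.

Definition bellman_init (v : 'I_n) : nat := if v \in V0 A then T else 0.

Definition bellman (f : 'I_n -> nat) : 'I_n -> nat :=
  foldr (relax f) bellman_init (edge_list A).

(** A minimum is at most [x] iff some entry is, a maximum iff all entries are. This removes the fold
    and its edge order from the game arguments. *)
Lemma bellman_leP f v x :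
  reflect
    (if v \in V0 A
     then T <= x \/ exists2 u, edge A v u & cost T (w v u) (f u) <= x
     else forall u, edge A v u -> cost T (w v u) (f u) <= x)
    (bellman f v <= x).
Proof.
pose q (e : 'I_n * 'I_n) := cost T (w e.1 e.2) (f e.2) <= x.
have foldE (l : seq ('I_n * 'I_n)) : (foldr (relax f) bellman_init l v <= x) =
    if v \in V0 A then (T <= x) || has [pred e | (e.1 == v) && q e] l
    else all [pred e | (e.1 == v) ==> q e] l.
  elim: l => [|[a b] l IH] /=; first by rewrite /bellman_init; case: ifP; rewrite ?orbF.
  rewrite {1}/relax /= (eq_sym a); case: eqP => [<-|_] /=; last exact: IH.
  case: ifP IH => _ IH; rewrite ?geq_min ?geq_max IH -/(q (v, b)).
    by rewrite -orbA (orbC (has _ _)).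
  by rewrite andbC.
rewrite /bellman foldE; case: ifP => _.
  apply: (iffP orP) => -[|]; [by left| |by left|].
    case/hasP=> -[a b]; rewrite mem_enum inE /= => ab /andP[/eqP av qab].
    by right; exists b; rewrite -av.
  case=> u vu cu; right; apply/hasP; exists (v, u); first by rewrite mem_enum.
  by rewrite /= eqxx.
apply: (iffP allP) => [H u vu|H [a b]].
  by have /= := H (v, u); rewrite mem_enum inE /= eqxx; apply.
by rewrite mem_enum inE /= => ab; apply/implyP => /eqP av; rewrite /q /= av; apply: H; rewrite -av.
Qed.

Lemma bellman_mono f g : (forall v, f v <= g v) -> forall v, bellman f v <= bellman g v.
Proof.
move=> fg v; apply/bellman_leP; have /bellman_leP := leqnn (bellman g v).
case: ifP => _.
  case=> [|[u vu cu]]; [by left | right; exists u => //].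
  by apply: leq_trans cu; apply: cost_mono.
by move=> H u vu; apply: leq_trans (H u vu); apply: cost_mono.
Qed.

Lemma bellman_le_top f : (forall v, f v <= T) -> forall v, bellman f v <= T.
Proof.
move=> fT v; apply/bellman_leP; case: ifP => _; first by left.
by move=> u _; apply: cost_le_top.
Qed.

Definition bellman_closed (f : 'I_n -> nat) := forall v, bellman f v <= f v.

Definition approx (i : nat) : 'I_n -> nat := iter i bellman (fun=> 0).

Lemma approx_le_top i v : approx i v <= T.
Proof. by elim: i v => //= i IH; apply: bellman_le_top. Qed.

Lemma approx_leS i v : approx i v <= approx i.+1 v.
Proof. by elim: i v => // i IH; apply: bellman_mono. Qed.

Lemma approx_least g : bellman_closed g -> forall i v, approx i v <= g v.
Proof.
move=> gc; elim=> //= i IH v.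
by apply: leq_trans (gc v); apply: bellman_mono.
Qed.

(* A round that is not yet closed raises the sum of the values, which is at most
   n * T. *)
Lemma approx_closed : bellman_closed (approx (n * T)).
Proof.
have [] : bellman_closed (approx (n * T)) \/ n * T <= \sum_v approx (n * T) v.
- elim: (n * T) => [|i [IH|IH]]; [by right| |].
  + by left; apply: bellman_mono.
  + have [/forallP C|] := boolP [forall v, bellman (approx i) v <= approx i v].
      by left; apply: bellman_mono.
    rewrite negb_forall => /existsP[v]; rewrite -ltnNge => lt_v.
    right; apply: leq_ltn_trans IH _.
    rewrite (bigD1 v) //= [X in _ < X](bigD1 v) //= -addSn.
    by apply: leq_add => //; apply: leq_sum => u _; apply: approx_leS.
- by [].
(* A sum of at least [n * T] forces every value up to [T], which the operator never exceeds. *)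
- move=> big v; apply: leq_trans (bellman_le_top (@approx_le_top _) v) _.
  have : \sum_u approx (n * T) u <= approx (n * T) v + \sum_(u | u != v) T.
    rewrite (bigD1 v) //= leq_add2l.
    by apply: leq_sum => u _; apply: approx_le_top.
  rewrite sum_nat_const cardC1 card_ord; have := ltn_ord v; nia.
Qed.

End Bellman.

(** * Compressing a closed valuation to [n] levels *)

Section Compress.
Variables (n : nat) (A : arena n) (w : rweight n) (T : nat) (f : 'I_n -> nat).
Hypothesis f_closed : bellman_closed A w T f.

Definition rank (v : 'I_n) : nat :=
  if f v < T then #|[set u | f u < f v]| else n.

Lemma rank_lt v : f v < T -> rank v < n.
Proof.
rewrite /rank => ->; rewrite -[X in _ < X]card_ord -cardsT.
by apply/proper_card/properP; split; [apply: subsetT | exists v; rewrite !inE ?ltnn].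
Qed.

Lemma rank_le v : rank v <= n.
Proof. by case: (ltnP (f v) T) => [/rank_lt/ltnW //|]; rewrite /rank leqNgt => /negbTE->. Qed.

(** A zero edge gives an inclusion of lower sets. A nonzero edge makes it strict, since [u] lies in
    the lower set of [v] but not in its own, so the rank drops by at least one. A winnable recharge
    target has rank below [n]. *)
Lemma cost_rank o u v :
  f v < T -> cost T o (f u) <= f v -> cost n o (rank u) <= rank v.
Proof.
move=> vT; case: o => [[|c]|] /=.
- move=> uv; rewrite /rank vT (leq_ltn_trans uv vT).
  by apply/subset_leq_card/subsetP => x; rewrite !inE => /leq_trans; apply.
- move=> le_uv; have uv : f u < f v by lia.
  rewrite geq_min; apply/orP; left; rewrite /rank vT (ltn_trans uv vT).
  apply/proper_card/properP; split; last by exists u; rewrite !inE ?ltnn.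
  by apply/subsetP => x; rewrite !inE => /ltn_trans; apply.
- by case: ltnP => [uT _|]; [rewrite (rank_lt uT) | lia].
Qed.

Lemma rank_closed : bellman_closed A w n rank.
Proof.
move=> v; case: (ltnP (f v) T) => [vT|].
  have /bellman_leP Hv := f_closed v; apply/bellman_leP.
  case: ifP Hv => _.
    case=> [|[u vu cu]]; first by lia.
    by right; exists u => //; apply: cost_rank.
  by move=> H u vu; apply: cost_rank => //; apply: H.
rewrite {2}/rank leqNgt => /negbTE->; exact/bellman_le_top/rank_le.
Qed.

End Compress.

(** * Winning strategies and Bellman-closed valuations *)

Section Outcome.
Variables (n : nat) (A : arena n).

Lemma prefixS (p : nat -> 'I_n) k : Defs.prefix p k.+1 = rcons (Defs.prefix p k) (p k).
Proof. by rewrite /Defs.prefix -addn1 iotaD map_cat cats1. Qed.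

Lemma size_prefix (p : nat -> 'I_n) k : size (Defs.prefix p k) = k.
Proof. by rewrite size_map size_iota. Qed.

(** A [tau] that sees only time and vertex is enough to steer Player 1 along any prescribed path.
    The iterated state carries the history for [sigma]. *)
Lemma outcome sigma (tau : nat -> 'I_n -> 'I_n) :
  strategy0 A sigma -> (forall j v, edge A v (tau j v)) ->
  exists q, [/\ play A q, consistent A sigma q &
                forall j, q j \notin V0 A -> q j.+1 = tau j (q j)].
Proof.
move=> sig tauE.
pose next (s : seq 'I_n * 'I_n) :=
  (rcons s.1 s.2, if s.2 \in V0 A then sigma s.1 s.2 else tau (size s.1) s.2).
pose st j := iter j next ([::], vI A).
pose q j := (st j).2.
have pre j : (st j).1 = Defs.prefix q j by elim: j => //= j IH; rewrite prefixS -IH.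
have qS j : q j.+1 = if q j \in V0 A then sigma (Defs.prefix q j) (q j) else tau j (q j).
  by rewrite {1}/q /= pre size_prefix.
exists q; split; last by move=> j /negbTE qj; rewrite qS qj.
- by split=> // j; rewrite qS; case: ifP => [/sig|].
- by move=> j qj; rewrite qS qj.
Qed.

(** Realizes each move of Player 1 by a consistent play with the same past, as needed for the
    maximum in the Bellman operator. *)
Lemma branch sigma p k u :
  arena_ok A -> strategy0 A sigma -> play A p -> consistent A sigma p ->
  p k \notin V0 A -> edge A (p k) u ->
  exists q, [/\ play A q, consistent A sigma q,
                forall j, j <= k -> q j = p j & q k.+1 = u].
Proof.
move=> okA sig [p0 pE] pco pk pu.
pose next j := if j < k then p j.+1 else u.
(* Where the prescribed target is not a successor, any successor will do; this cannot occur up to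
   time [k]. *)
pose tau j v := if edge A v (next j) then next j else xchoose (okA v).
have [|q [[q0 qE] qco qtau]] := @outcome sigma tau sig.
  by move=> j v; rewrite /tau; case: ifP => // _; apply: (xchooseP (okA v)).
have qp j : j <= k -> q j = p j /\ Defs.prefix q j = Defs.prefix p j.
  elim: j => [|j IH] jk; first by rewrite p0.
  have [qj preq] := IH (ltnW jk); rewrite !prefixS preq qj; split=> //.
  case: (boolP (p j \in V0 A)) => [pj|]; first by rewrite qco qj ?preq ?pco.
  by rewrite -qj => /qtau ->; rewrite qj /tau /next jk pE.
exists q; split=> // [j /qp[] //|].
have [qk _] := qp k (leqnn k).
by rewrite qtau qk // /tau /next ltnn pu.
Qed.

Lemma eq_ELcap w cap (p q : nat -> 'I_n) k :
  (forall j, j <= k -> q j = p j) -> ELcap w cap q k = ELcap w cap p k.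
Proof.
elim: k => //= k IH pq; rewrite !pq // IH // => j jk; exact/pq/leqW.
Qed.

End Outcome.

(** * Correctness of value iteration *)

Section Correct.
Variables (n : nat) (A : arena n) (w : rweight n).
Hypothesis okA : arena_ok A.

(** Induction on the rounds: the move of [sigma] is a candidate for the minimum at a vertex of
    Player 0, and [branch] covers every entry of the maximum at a vertex of Player 1. *)
Lemma approx_le_energy cap sigma :
  strategy0 A sigma ->
  (forall p, play A p -> consistent A sigma p -> Recharge w cap p) ->
  forall i p k, play A p -> consistent A sigma p ->
    ((approx A w cap.+1 i (p k))%:Z <= ELcap w cap p k)%R.
Proof.
move=> sig win; elim=> [|i IH] p k pl co; first exact: win.
have [x xE] : exists x : nat, ELcap w cap p k = Posz x.
  by have := win p pl co k; case: (ELcap _ _ _ _) => // x _; exists x.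
have step q : play A q -> consistent A sigma q ->
    (forall j, j <= k -> q j = p j) ->
    cost cap.+1 (w (p k) (q k.+1)) (approx A w cap.+1 i (q k.+1)) <= x.
  move=> qpl qco qp; have := IH q k.+1 qpl qco.
  rewrite /= (eq_ELcap w cap qp) xE (qp k) //.
  (* After a recharge the energy is [cap], so the target value is below the top level [cap.+1] and
     the edge costs 0. *)
  by case: (w _ _) => [[|c]|] /=; try lia; case: ltnP; lia.
rewrite xE lez_nat; apply/bellman_leP; case: ifP => [pk|/negbT pk].
  by right; exists (p k.+1); [case: pl | apply: step].
move=> u /(branch okA sig pl co pk)[q [qpl qco qp <-]]; exact: step.
Qed.

(** A nonzero weight is at most [W] and uses up at least one level, so along greedy play the energy
    stays at least [W] times the current level; [n] levels make capacity [n * W] enough. *)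
Lemma closed_wins f :
  bellman_closed A w n f -> f (vI A) < n -> exists cap, wins0 A (Recharge w cap).
Proof.
move=> fc fI.
pose W := \max_u \max_v odflt 0 (w u v).
have wW u v c : w u v = Some c -> c <= W.
  move=> e; apply: leq_trans (leq_bigmax u).
  by apply: leq_trans (leq_bigmax v); rewrite e.
exists (n * W).
pose good v u := edge A v u && (cost n (w v u) (f u) <= f v).
(* The default only keeps [sigma] legal: closedness provides a good successor at every vertex of
   Player 0 with value below [n]. *)
pose sigma (x : seq 'I_n) v := odflt (xchoose (okA v)) [pick u | good v u].
exists sigma; split.
  move=> x v _; rewrite /sigma; case: pickP => [u /andP[]|_] //=.
  exact: (xchooseP (okA v)).
move=> p [p0 pE] co.
have inv k : f (p k) < n /\ ((f (p k) * W)%:Z <= ELcap w (n * W) p k)%R.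
  elim: k => [|k [fk IH]]; first by rewrite p0 /=; split=> //; nia.
  have : cost n (w (p k) (p k.+1)) (f (p k.+1)) <= f (p k).
    have /bellman_leP := fc (p k); case: ifP => [pk|_]; last by apply.
    case=> [|[u ku cu]]; first by lia.
    rewrite co // /sigma; case: pickP => [v /andP[] //|/(_ u)].
    by rewrite /good ku cu.
  move=> /=; case E: (w _ _) => [[|c]|] /=.
  - by rewrite subr0 => le_f; split; [lia|nia].
  - by have := wW _ _ _ E => cW le_f; split; [lia|nia].
  - by case: ltnP => [lt_f _|]; [split=> //; nia | lia].
move=> k; have [_] := inv k; lia.
Qed.

Lemma approx_correct :
  approx A w n (n * n) (vI A) < n <-> exists cap, wins0 A (Recharge w cap).
Proof.
split=> [|[cap [sigma [sig win]]]]; first exact/closed_wins/approx_closed.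
pose g := approx A w cap.+1 (n * cap.+1).
have gI : g (vI A) < cap.+1.
  (* The bound is read off at time 0 of a consistent play, so one must exist; Player 1 moves
     arbitrarily. *)
  have [q [[q0 qE] qco]] : exists q, play A q /\ consistent A sigma q.
    have tauE (j : nat) v := xchooseP (okA v).
    by have [q []] := outcome sig tauE; exists q.
  have := approx_le_energy sig win (n * cap.+1) 0 (conj q0 qE) qco.
  by rewrite q0 /= lez_nat ltnS.
(* The rank of [g] is closed for [n] levels and hence dominates all iterates with top level [n]. *)
apply: leq_ltn_trans (rank_lt gI).
exact/approx_least/rank_closed/approx_closed.
Qed.

End Correct.

(** * Structured RAM programs *)

Inductive cmd :=
| Code of seq instr
| Seq of cmd & cmd
| Ifz of nat & cmd & cmd
| While of nat & cmd.

Fixpoint len c :=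
  match c with
  | Code s => size s
  | Seq c1 c2 => len c1 + len c2
  | Ifz _ c1 c2 => len c1 + len c2 + 2
  | While _ c => len c + 2
  end.

(** Jump targets are absolute, hence the argument [pc]. As [IJz] jumps on zero, the nonzero branch
    comes first, as the fall-through. *)
Fixpoint compile pc c : seq instr :=
  match c with
  | Code s => s
  | Seq c1 c2 => compile pc c1 ++ compile (pc + len c1) c2
  | Ifz r c1 c2 =>
      let l := pc.+1 + len c2 + 1 in
      (IJz r l :: compile pc.+1 c2) ++ IJmp (l + len c1) :: compile l c1
  | While r c => (IJz r (pc.+1 + len c + 1) :: compile pc.+1 c) ++ [:: IJmp pc]
  end.

Lemma size_compile pc c : size (compile pc c) = len c.
Proof.
elim: c pc => //= [c1 IH1 c2 IH2|_ c1 IH1 c2 IH2|_ c IH] pc.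
- by rewrite size_cat IH1 IH2.
- by rewrite size_cat /= IH1 IH2; lia.
- by rewrite size_cat /= IH; lia.
Qed.

Definition placed prog pc (s : seq instr) :=
  forall i, i < size s -> nth IHalt prog (pc + i) = nth IHalt s i.

Lemma placed_cat prog pc s1 s2 :
  placed prog pc (s1 ++ s2) <-> placed prog pc s1 /\ placed prog (pc + size s1) s2.
Proof.
split=> [H|[H1 H2] i]; last first.
  rewrite size_cat nth_cat => lt_i; case: ltnP => le_i; first exact: H1.
  by rewrite -H2 ?ltn_subLR // -addnA subnKC.
split=> i lt_i; first by rewrite H ?nth_cat ?lt_i // size_cat ltn_addr.
by rewrite -addnA H ?size_cat ?ltn_add2l // nth_cat ltnNge leq_addr addKn.
Qed.

Lemma placed_cons prog pc i s :
  placed prog pc (i :: s) -> nth IHalt prog pc = i /\ placed prog pc.+1 s.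
Proof.
move=> H; split; first by have := H 0 isT; rewrite addn0.
by move=> j lt_j; have := H j.+1 lt_j; rewrite addnS.
Qed.

(** Quantifying over the leftover budget makes times additive under composition without mentioning
    halting. *)
Definition reaches prog t pc m pc' m' :=
  forall s, exec prog (t + s) pc m = exec prog s pc' m'.

Lemma reaches_trans prog t1 t2 pc1 pc2 pc3 m1 m2 m3 :
  reaches prog t1 pc1 m1 pc2 m2 -> reaches prog t2 pc2 m2 pc3 m3 ->
  reaches prog (t1 + t2) pc1 m1 pc3 m3.
Proof. by move=> H1 H2 s; rewrite -addnA H1 H2. Qed.

(* Cells below K are registers, listed in rs; the rest of the memory is h. *)
Definition rep K (m : nat -> nat) (rs : seq nat) (h : nat -> nat) :=
  (forall a, a < K -> m a = nth 0 rs a) /\ (forall a, K <= a -> m a = h a).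

(** * Timed Hoare triples and weakest preconditions *)

Definition state_pred := seq nat -> (nat -> nat) -> Prop.

Definition triple K (P : state_pred) c T (Q : state_pred) :=
  forall prog pc m rs h,
    placed prog pc (compile pc c) -> rep K m rs h -> P rs h ->
    exists t m' rs' h',
      [/\ t <= T, reaches prog t pc m (pc + len c) m', rep K m' rs' h' & Q rs' h'].

(** Indirect accesses must stay at or above [K], so they never alias a register. Raw jumps are
    rejected; control flow comes from [Ifz] and [While] only. *)
Definition wp_instr K i (Q : state_pred) : state_pred := fun rs h =>
  match i with
  | IConst r c => Q (set_nth 0 rs r c) h
  | IAdd r a b => Q (set_nth 0 rs r (nth 0 rs a + nth 0 rs b)) h
  | ISub r a b => Q (set_nth 0 rs r (nth 0 rs a - nth 0 rs b)) h
  | ILoad r a => K <= nth 0 rs a /\ Q (set_nth 0 rs r (h (nth 0 rs a))) h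
  | IStore a b => K <= nth 0 rs a /\ Q rs (upd h (nth 0 rs a) (nth 0 rs b))
  | _ => False
  end.

Fixpoint wp K c (Q : state_pred) : state_pred :=
  match c with
  | Code s => foldr (wp_instr K) Q s
  | Seq c1 c2 => wp K c1 (wp K c2 Q)
  | Ifz r c1 c2 => fun rs h => if nth 0 rs r is 0 then wp K c1 Q rs h else wp K c2 Q rs h
  | While _ _ => fun _ _ => False
  end.

Definition regs_lt_instr K i :=
  match i with
  | IConst r _ => r < K
  | IAdd r a b | ISub r a b => [&& r < K, a < K & b < K]
  | ILoad r a | IStore r a => (r < K) && (a < K)
  | _ => true
  end.

Fixpoint regs_lt K c :=
  match c with
  | Code s => all (regs_lt_instr K) s
  | Seq c1 c2 => regs_lt K c1 && regs_lt K c2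
  | Ifz r c1 c2 => [&& r < K, regs_lt K c1 & regs_lt K c2]
  | While r c => (r < K) && regs_lt K c
  end.

Lemma rep_upd_reg K m rs h r x :
  r < K -> rep K m rs h -> rep K (upd m r x) (set_nth 0 rs r x) h.
Proof.
move=> rK [mr mh]; split=> a aK; rewrite /upd ?nth_set_nth /=; case: eqP => // e.
- exact: mr.
- by move: rK; rewrite -e ltnNge aK.
- exact: mh.
Qed.

Lemma rep_upd_heap K m rs h r x :
  K <= r -> rep K m rs h -> rep K (upd m r x) rs (upd h r x).
Proof.
move=> Kr [mr mh]; split=> a aK; rewrite /upd; case: eqP => // e.
- by move: aK; rewrite e ltnNge Kr.
- exact: mr.
- exact: mh.
Qed.

Lemma wp_instr_sound K i (Q : state_pred) prog pc m rs h :
  nth IHalt prog pc = i -> regs_lt_instr K i -> rep K m rs h ->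
  wp_instr K i Q rs h ->
  exists m' rs' h', [/\ reaches prog 1 pc m pc.+1 m', rep K m' rs' h' & Q rs' h'].
Proof.
move=> progE ok R; have [mr mh] := R.
case: i progE ok => [r c|r a b|r a b|r a|a b|r l|l|] progE //=.
- move=> rK HQ; exists (upd m r c), (set_nth 0 rs r c), h.
  by split=> //; [move=> s; rewrite /= progE | apply: rep_upd_reg].
- case/and3P=> rK aK bK HQ; do 3 eexists; split; last exact: HQ.
    by move=> s; rewrite /= progE.
  by rewrite -!mr //; apply: rep_upd_reg.
- case/and3P=> rK aK bK HQ; do 3 eexists; split; last exact: HQ.
    by move=> s; rewrite /= progE.
  by rewrite -!mr //; apply: rep_upd_reg.
- case/andP=> rK aK [Ka HQ]; do 3 eexists; split; last exact: HQ.
    by move=> s; rewrite /= progE.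
  by rewrite -mh // -!mr //; apply: rep_upd_reg.
- case/andP=> aK bK [Ka HQ]; do 3 eexists; split; last exact: HQ.
    by move=> s; rewrite /= progE.
  by rewrite -!mr //; apply: rep_upd_heap => //; rewrite mr.
Qed.

(** [wp] is false on loops, so each instruction runs at most once and the code length bounds the
    time. *)
Lemma triple_wp K (P : state_pred) c Q :
  regs_lt K c -> (forall rs h, P rs h -> wp K c Q rs h) -> triple K P c (len c) Q.
Proof.
move=> ok H prog pc m rs h at_c R /H {H}.
elim: c Q ok pc m rs h at_c R => [s|c1 IH1 c2 IH2|r c1 IH1 c2 IH2|r c _] //= Q.
- elim: s => [_|i s IHs /= /andP[iK sK]] pc m rs h at_c R /=.
    by move=> HQ; exists 0, m, rs, h; rewrite addn0; split.
  case/placed_cons: at_c => progi at_s.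
  case/(wp_instr_sound progi iK R) => m1 [rs1 [h1 [st R1 H1]]].
  have [t [m2 [rs2 [h2 [le_t st2 R2 HQ]]]]] := IHs sK pc.+1 m1 rs1 h1 at_s R1 H1.
  exists (1 + t), m2, rs2, h2; split=> //.
  by rewrite addnS -addSn; apply: reaches_trans st st2.
- case/andP=> ok1 ok2 pc m rs h /placed_cat[at1]; rewrite size_compile => at2 R.
  case/(IH1 _ ok1 _ _ _ _ at1 R) => t1 [m1 [rs1 [h1 [le1 st1 R1]]]].
  case/(IH2 _ ok2 _ _ _ _ at2 R1) => t2 [m2 [rs2 [h2 [le2 st2 R2 HQ]]]].
  exists (t1 + t2), m2, rs2, h2; split=> //; first exact: leq_add.
  by rewrite addnA; apply: reaches_trans st1 st2.
- case/and3P=> rK ok1 ok2 pc m rs h.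
  rewrite -cat_cons => /placed_cat[/placed_cons[prog1 at2]] /=.
  rewrite size_compile => /placed_cons[prog2 at1] R.
  have st s : exec prog (1 + s) pc m =
    if nth 0 rs r == 0 then exec prog s (pc.+1 + len c2 + 1) m else exec prog s pc.+1 m.
    by rewrite /= prog1 (proj1 R).
  case rE: (nth 0 rs r) st => [|x] st.
    rewrite (_ : (pc + _).+1 = pc.+1 + len c2 + 1) in at1; last by lia.
    case/(IH1 _ ok1 _ _ _ _ at1 R) => t1 [m1 [rs1 [h1 [le1 st1 R1 HQ]]]].
    exists (1 + t1), m1, rs1, h1; split=> //; first by lia.
    have -> : pc + (len c1 + len c2 + 2) = pc.+1 + len c2 + 1 + len c1 by lia.
    exact: reaches_trans st st1.
  case/(IH2 _ ok2 _ _ _ _ at2 R) => t1 [m1 [rs1 [h1 [le1 st1 R1 HQ]]]].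
  exists (1 + (t1 + 1)), m1, rs1, h1; split=> //; first by lia.
  apply: (reaches_trans st); apply: (reaches_trans st1) => s.
  rewrite /= addSn -addnS prog2; congr exec; lia.
Qed.

Lemma triple_conseq K (P P' : state_pred) c T T' (Q Q' : state_pred) :
  triple K P c T Q -> T <= T' ->
  (forall rs h, P' rs h -> P rs h) -> (forall rs h, Q rs h -> Q' rs h) ->
  triple K P' c T' Q'.
Proof.
move=> H le_T PP QQ prog pc m rs h at_c R /PP HP.
have [t [m1 [rs1 [h1 [le_t st R1 /QQ HQ]]]]] := H prog pc m rs h at_c R HP.
by exists t, m1, rs1, h1; split=> //; apply: leq_trans le_T.
Qed.

Lemma triple_seq K (P : state_pred) c1 T1 Q c2 T2 S :
  triple K P c1 T1 Q -> triple K Q c2 T2 S ->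
  triple K P (Seq c1 c2) (T1 + T2) S.
Proof.
move=> H1 H2 prog pc m rs h /= /placed_cat[at1].
rewrite size_compile => at2 R HP.
have [t1 [m1 [rs1 [h1 [le1 st1 R1 HQ]]]]] := H1 prog pc m rs h at1 R HP.
have [t2 [m2 [rs2 [h2 [le2 st2 R2 HS]]]]] := H2 prog _ m1 rs1 h1 at2 R1 HQ.
exists (t1 + t2), m2, rs2, h2; split=> //; first exact: leq_add.
by rewrite addnA; apply: reaches_trans st1 st2.
Qed.

(** The index of the invariant is the loop register itself, which gives termination. A pass adds 2
    steps, for the test and the jump back; the final test adds 1. *)
Lemma triple_while K (Inv : nat -> state_pred) r c T :
  r < K ->
  (forall k rs h, Inv k rs h -> nth 0 rs r = k) ->
  (forall k, triple K (Inv k.+1) c T (Inv k)) ->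
  forall k, triple K (Inv k) (While r c) (k * (T + 2) + 1) (Inv 0).
Proof.
move=> rK InvE H k prog pc m rs h /=.
rewrite -cat_cons => /placed_cat[/placed_cons[prog1 at_c]] /=.
rewrite size_compile => /placed_cons[prog2 _].
elim: k m rs h => [|k IH] m rs h R HI.
  exists 1, m, rs, h; split=> //.
  move=> s; rewrite /= prog1 (proj1 R) // (InvE _ _ _ HI) /=; congr exec; lia.
have [t1 [m1 [rs1 [h1 [le1 st1 R1 HI1]]]]] := H k prog _ m rs h at_c R HI.
have [t2 [m2 [rs2 [h2 [le2 st2 R2 HI2]]]]] := IH m1 rs1 h1 R1 HI1.
exists (1 + (t1 + (1 + t2))), m2, rs2, h2; split=> //; first by lia.
apply: (@reaches_trans _ _ _ _ pc.+1 _ _ m).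
  by move=> s; rewrite /= prog1 (proj1 R) // (InvE _ _ _ HI).
apply: (reaches_trans st1); apply: reaches_trans st2 => s.
by rewrite /= addSn -addnS prog2.
Qed.

(** * The program *)

Section Encoding.
Variables (n : nat) (A : arena n) (w : rweight n).

Definition edge_code (e : 'I_n * 'I_n) : seq nat :=
  [:: val e.1; val e.2;
      (if w e.1 e.2 is Some _ then 0 else 1);
      (if w e.1 e.2 is Some c then c else 0)].

Lemma nth_edge_code (l : seq ('I_n * 'I_n)) e0 k j :
  k < size l -> j < 4 ->
  nth 0 (flatten [seq edge_code e | e <- l]) (4 * k + j) =
  nth 0 (edge_code (nth e0 l k)) j.
Proof.
move=> + j4; elim: l k => // e l IH [|k] lt_k; first by clear IH; case: j j4 => [|[|[|[|]]]].
by rewrite mulnS -addnA; apply: IH.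
Qed.

Lemma size_encode : size (encode A w) = 3 + n + 4 * size (edge_list A).
Proof.
rewrite /encode /= !size_cat size_map size_enum_ord /= size_flatten.
rewrite /shape -map_comp (eq_map (g := fun=> 4)) //.
have -> l : sumn [seq (fun=> 4) (e : 'I_n * 'I_n) | e <- l] = 4 * size l.
  by elim: l => //= e l ->; rewrite mulnS.
by lia.
Qed.

Lemma nth_encode_flag (v : 'I_n) : nth 0 (encode A w) (2 + v) = (v \notin V0 A).
Proof.
rewrite /encode /= nth_cat size_map size_enum_ord ltn_ord.
by rewrite add0n (nth_map v) ?size_enum_ord // nth_ord_enum.
Qed.

Lemma nth_encode_count : nth 0 (encode A w) (2 + n) = size (edge_list A).
Proof. by rewrite /encode /= nth_cat size_map size_enum_ord ltnn subnn. Qed.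

Lemma nth_encode_edge e0 k j :
  k < size (edge_list A) -> j < 4 ->
  nth 0 (encode A w) (3 + n + (4 * k + j)) =
  nth 0 (edge_code (nth e0 (edge_list A) k)) j.
Proof.
move=> lt_k j4; rewrite -(nth_edge_code e0 lt_k j4) /encode /=.
rewrite nth_cat size_map size_enum_ord ifN; last by lia.
by rewrite (_ : _ - n = (4 * k + j).+1) //; lia.
Qed.

End Encoding.

Ltac run_wp body :=
  cbv beta iota zeta delta [body wp wp_instr foldr nth set_nth mkseq map iota].

Lemma upd_same h a x : upd h a x a = x.
Proof. by rewrite /upd eqxx. Qed.

Lemma upd_other h a b x : b != a -> upd h a x b = h b.
Proof. by rewrite /upd => /negbTE->. Qed.

(** * Moving the input away from the registers *)

Definition copy_body : cmd :=
  Code [:: ILoad 5 3; IStore 0 5; IAdd 0 0 1; IAdd 3 3 1; ISub 4 4 1].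

(* Only cell 0 is free at the start: it is turned into B = 16 * size, an address
   beyond the input, and each cell is freed by saving it at B + its index. *)
Definition relocate : cmd :=
  Seq (Code [:: IAdd 0 0 0; IAdd 0 0 0; IAdd 0 0 0; IAdd 0 0 0;
                IStore 0 1; IConst 1 1; IAdd 0 0 1; IStore 0 2; ISub 2 0 1;
                IAdd 0 0 1; IStore 0 3; IAdd 0 0 1; IStore 0 4;
                IAdd 0 0 1; IStore 0 5; IAdd 0 0 1; IConst 3 6; ISub 4 2 3])
      (While 4 copy_body).

Section Relocate.
Variables (s : seq nat).
Hypothesis s_gt0 : 0 < size s.
Let B := 16 * size s.

(** Cell 0 held the length and is not copied, so cell [a] goes to [B + a - 1]; this is the
    off-by-one between [dst] and [src]. Copying runs on to [B], past the input, where only zeros are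
    moved. *)
Definition copy_inv k : state_pred := fun rs h =>
  exists dst src x,
    [/\ rs = [:: dst; 1; B; src; k; x], src + k = B /\ dst.+1 = B + src,
        forall i, i.+1 < src -> h (B + i) = nth 0 s i,
        forall a, src <= a < B -> h a = nth 0 s a.-1 &
        5 < src /\ forall a, dst <= a -> h a = 0].

Lemma copy_triple k : triple 6 (copy_inv k.+1) copy_body 5 (copy_inv k).
Proof.
apply: triple_wp => [//|rs h [dst [src [x [-> [e1 e2] lo mid [src6 hi]]]]]].
run_wp copy_body; rewrite subSS subn0; split; first by lia.
split; first by lia.
exists (dst + 1), (src + 1), (h src); split=> //; first by lia.
- move=> i lt_i; rewrite /upd; case: eqP => [e|ne]; last by apply: lo; lia.
  by rewrite mid; [congr nth; lia | lia].
- by move=> a a_in; rewrite upd_other; [apply: mid; lia | lia].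
- by split; [lia | move=> a le_a; rewrite upd_other; [apply: hi; lia | lia]].
Qed.

Lemma relocate_triple :
  triple 6 (fun rs h => rs = [:: size s; nth 0 s 0; nth 0 s 1; nth 0 s 2; nth 0 s 3; nth 0 s 4]
                        /\ h = init_mem s)
    relocate (18 + ((B - 6) * 7 + 1)) (copy_inv 0).
Proof.
apply: triple_seq; last first.
  apply: (@triple_while 6 copy_inv 4 copy_body 5) => //.
    by move=> k rs h [dst [src [x [->]]]].
  exact: copy_triple.
apply: triple_wp => [//|rs h [-> ->]]; run_wp relocate.
have -> : size s + size s + (size s + size s) + (size s + size s + (size s + size s)) +
   (size s + size s + (size s + size s) + (size s + size s + (size s + size s))) = B.
  by rewrite /B; lia.
have B16 : 16 <= B by rewrite /B; lia.
have sB : size s < B by rewrite /B; lia.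
rewrite !addnK; do 5!(split; first by lia).
exists (B + 1 + 1 + 1 + 1 + 1), 6, (nth 0 s 4); split=> //; first by lia.
- move=> i lt_i; rewrite -!addnA /= /upd !eqn_add2l.
  by case: i lt_i => [|[|[|[|[|]]]]].
- by move=> a a_in; rewrite !upd_other /init_mem; try lia; case: a a_in.
- split=> // a le_a; rewrite !upd_other /init_mem; try lia.
  by case: a le_a => [|a] le_a; [lia | rewrite nth_default //; lia].
Qed.

End Relocate.

(* Registers of the main program: 0 holds 0, 1 holds 1, 2 the base B of the input
   copy, 3 the number n of vertices, 4 and 5 the bases of the current values and
   of the values under construction, 6 the base of the owner flags, 7 the base of
   the edges, 8 the number of edges, 9 the rounds left, 10 the loop counter. *)
Definition vertex_body : cmd :=
  Seq (Code [:: ISub 10 10 1; IAdd 11 5 10; ILoad 12 11; IAdd 13 4 10; IStore 13 12;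
                IAdd 12 6 10; ILoad 12 12])
      (Ifz 12 (Code [:: IStore 11 3]) (Code [:: IStore 11 0])).

(** An edge record has four cells, so its offset is found by doubling twice. Minimum and maximum are
    [a - (a - b)] and [a + (b - a)] in truncated subtraction. *)
Definition edge_body : cmd :=
  Seq (Code [:: ISub 10 10 1; IAdd 11 10 10; IAdd 11 11 11; IAdd 11 7 11;
                ILoad 12 11; IAdd 11 11 1; ILoad 13 11; IAdd 11 11 1;
                ILoad 14 11; IAdd 11 11 1; ILoad 15 11; IAdd 13 4 13; ILoad 13 13])
 (Seq (Ifz 14
        (Ifz 15 (Code [::]) (Code [:: IAdd 13 13 1; ISub 14 13 3; ISub 13 13 14]))
        (Seq (Code [:: ISub 14 3 13]) (Ifz 14 (Code [::]) (Code [:: IConst 13 0]))))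
 (Seq (Code [:: IAdd 14 6 12; ILoad 14 14; IAdd 12 5 12; ILoad 15 12])
 (Seq (Ifz 14 (Code [:: ISub 14 15 13; ISub 15 15 14])
              (Code [:: ISub 14 13 15; IAdd 15 15 14]))
      (Code [:: IStore 12 15])))).

Definition round_body : cmd :=
  Seq (Code [:: IAdd 10 3 0])
 (Seq (While 10 vertex_body)
 (Seq (Code [:: IAdd 10 8 0])
 (Seq (While 10 edge_body)
      (Code [:: ISub 9 9 1])))).

(** Without multiplication, the number [n * n] of rounds is obtained by repeated addition. *)
Definition square_body : cmd := Code [:: IAdd 9 9 3; ISub 10 10 1].

Definition main : cmd :=
  Seq (Code [:: IConst 0 0; ILoad 3 2; IAdd 4 2 2; IAdd 5 4 2; IAdd 6 2 1; IAdd 6 6 1;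
                IAdd 7 6 3; ILoad 8 7; IAdd 7 7 1; IConst 9 0; IAdd 10 3 0])
 (Seq (While 10 square_body)
 (Seq (While 9 round_body)
 (Seq (Code [:: IAdd 10 2 1; ILoad 10 10; IAdd 10 5 10; ILoad 10 10; ISub 0 3 10])
      (Ifz 0 (Code [::]) (Code [:: IConst 0 1]))))).

(** * Verification of the main program *)

Section Main.
Variables (n : nat) (A : arena n) (w : rweight n) (B : nat).
Let s := encode A w.
Let es := edge_list A.
Let m := size es.
Let F := B + B.
Let G := B + B + B.
Let O := B + 1 + 1.
Let E := B + 1 + 1 + n + 1.
Hypothesis B_ge16 : 16 <= B.
Hypothesis B_gt_s : (size s).+1 < B.

Definition layout (h : nat -> nat) := forall i, i < size s -> h (B + i) = nth 0 s i.

Lemma layout_upd h a x : F <= a -> layout h -> layout (upd h a x).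
Proof. by rewrite /F => Fa H i lt_i; rewrite upd_other ?H //; lia. Qed.

Lemma layout_flag h v : layout h -> v < n -> h (O + v) = nth 0 s (2 + v).
Proof.
move=> H lt_v; rewrite -H; first by congr h; rewrite /O; lia.
by rewrite /s size_encode; lia.
Qed.

Lemma layout_edge h e0 k : layout h -> k < m ->
  let e := nth e0 es k in let a := E + (k + k + (k + k)) in
  [/\ h a = e.1, h (a + 1) = e.2,
      h (a + 1 + 1) = (if w e.1 e.2 is Some _ then 0 else 1) &
      h (a + 1 + 1 + 1) = (if w e.1 e.2 is Some c then c else 0)].
Proof.
move=> H lt_k e a.
have aE j : j < 4 -> h (a + j) = nth 0 (edge_code w e) j.
  move=> j4; rewrite /e -(nth_encode_edge w e0 lt_k j4) -H; first by congr h; rewrite /a /E; lia.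
  by rewrite /s size_encode -/m; rewrite -/es -/m in lt_k *; lia.
by have := (aE 0 isT, aE 1 isT, aE 2 isT, aE 3 isT); rewrite /= addn0 -!addnA => -[[[]]].
Qed.

Definition regs r j : state_pred := fun rs h => layout h /\
  exists x1 x2 x3 x4 x5,
    rs = [:: 0; 1; B; n; F; G; O; E; m; r; j; x1; x2; x3; x4; x5].

Definition array a (f : 'I_n -> nat) (h : nat -> nat) := forall v : 'I_n, h (a + v) = f v.

(** The loop counts down: from [k] on, the old values are saved at [F] and the cells at [G] are
    reset. *)
Definition vertex_inv g r k : state_pred := fun rs h =>
  [/\ regs r k rs h, k <= n, forall v : 'I_n, v < k -> h (G + v) = g v &
      forall v : 'I_n, k <= v -> h (F + v) = g v /\ h (G + v) = bellman_init A n v].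

Lemma vertex_triple g r k :
  triple 16 (vertex_inv g r k.+1) vertex_body 11 (vertex_inv g r k).
Proof.
apply: triple_wp => [//|rs h [[lay [x1 [x2 [x3 [x4 [x5 ->]]]]]] kn lo hi]].
run_wp vertex_body; rewrite subSS subn0; do 3!(split; first by rewrite /F /G /O; lia).
have n_lt_s : n < size s by rewrite /s size_encode; lia.
pose v := Ordinal kn; have kv : k = v by [].
have lay1 : layout (upd h (F + k) (h (G + k))) by apply: layout_upd; rewrite ?leq_addr.
rewrite layout_flag // {1}kv nth_encode_flag.
have fin x y1 y2 y3 y4 y5 : x = bellman_init A n v ->
  vertex_inv g r k [:: 0; 1; B; n; F; G; O; E; m; r; k; y1; y2; y3; y4; y5]
    (upd (upd h (F + k) (h (G + k))) (G + k) x).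
  move=> xE; split; last 1 first.
  - move=> u; rewrite leq_eqVlt => /orP[/eqP ku|ku].
      have -> : u = v by apply: val_inj.
      rewrite -kv upd_same upd_other ?upd_same; last by rewrite /F /G; lia.
      by split=> //; apply: (lo v).
    have un := ltn_ord u.
    by rewrite !upd_other; [exact: hi | rewrite /F /G; lia ..].
  - by split; [apply: layout_upd; rewrite // /F /G; lia | do 5 eexists].
  - exact: ltnW.
  - move=> u ku; have un := ltn_ord u.
    by rewrite !upd_other; [apply: lo; lia | rewrite /F /G; lia ..].
case vV: (v \in V0 A) => /=; (split; first by rewrite /G; lia);
  by apply: fin; rewrite /bellman_init vV.
Qed.

(** Counting down treats the last edge first, in the order of [foldr]; at [k = 0] a full Bellman
    round is done. *)
Definition edge_inv f r k : state_pred := fun rs h =>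
  [/\ regs r k rs h, k <= m, array F f h &
      array G (foldr (relax A w n f) (bellman_init A n) (drop k es)) h].

(** The bound on [f] is needed for recharge edges: the code leaves an unwinnable target value
    unchanged, which is the cost [n] only if the value is exactly [n]. *)
Lemma edge_triple f r k :
  (forall v, f v <= n) ->
  triple 16 (edge_inv f r k.+1) edge_body (len edge_body) (edge_inv f r k).
Proof.
move=> f_le; apply: triple_wp => [//|rs h [[lay [x1 [x2 [x3 [x4 [x5 ->]]]]]] km hF hG]].
pose e := nth (vI A, vI A) es k.
have n_lt_s : n < size s by rewrite /s size_encode; lia.
have [h1 h2 h3 h4] := layout_edge (vI A, vI A) lay km.
run_wp edge_body; rewrite subSS subn0 h1 h2 h3 h4 -/e hF hG layout_flag // nth_encode_flag.
set g := foldr _ _ _ in hG *.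
have fin x y1 y2 y3 y4 y5 : x = relax A w n f e g e.1 ->
  edge_inv f r k [:: 0; 1; B; n; F; G; O; E; m; r; k; y1; y2; y3; y4; y5]
    (upd h (G + e.1) x).
  move=> xE; split.
  - by split; [apply: layout_upd; rewrite // /F /G; lia | do 5 eexists].
  - exact: ltnW.
  - move=> v; rewrite upd_other ?hF //.
    by have := ltn_ord v; rewrite /F /G; lia.
  - move=> v; rewrite (drop_nth (vI A, vI A) km) -/e /= -/g /upd eqn_add2l.
    case: eqP => [/val_inj ->|ne]; first by [].
    by rewrite hG /relax; case: eqP => // ve; case: ne; rewrite ve.
have fe := f_le e.2.
case Ew: (w e.1 e.2) => [[|c]|]; [| |case nf: (n - f e.2) => [|x]];
  case vV: (e.1 \in V0 A);
  do 9?[split; first by rewrite /F /G /O /E; lia];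
  by apply: fin; rewrite /relax eqxx vV Ew /cost /=; try case: ltnP; lia.
Qed.

Definition round_inv r : state_pred := fun rs h =>
  [/\ exists j, regs r j rs h, r <= n * n &
      array G (approx A w n (n * n - r)) h].

Lemma round_triple r :
  triple 16 (round_inv r.+1) round_body (n * 13 + m * 37 + 5) (round_inv r).
Proof.
case: (ltnP r (n * n)) => [lt_r|le_r]; last first.
  by move=> prog pc mm rs h _ _ [_]; rewrite ltnNge le_r.
pose g := approx A w n (n * n - r.+1).
have g_le : forall v, g v <= n by apply: approx_le_top.
have -> : n * 13 + m * 37 + 5 = 1 + ((n * (11 + 2) + 1) +
   (1 + ((m * (len edge_body + 2) + 1) + 1))).
  by rewrite (_ : len edge_body = 35) //; lia.
apply: (triple_seq (Q := vertex_inv g r.+1 n)).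
  apply: triple_wp => [//|rs h [[j [lay [x1 [x2 [x3 [x4 [x5 ->]]]]]]] rn hG]].
  run_wp round_body; rewrite addn0.
  split=> // [|v]; first by split=> //; do 5 eexists.
  by rewrite leqNgt ltn_ord.
apply: (triple_seq (Q := vertex_inv g r.+1 0)).
  apply: (@triple_while 16 (vertex_inv g r.+1)) => // [k rs h|k].
    by case=> [[_ [x1 [x2 [x3 [x4 [x5 ->]]]]]]].
  exact: vertex_triple.
apply: (triple_seq (Q := edge_inv g r.+1 m)).
  apply: triple_wp => [//|rs h [[lay [x1 [x2 [x3 [x4 [x5 ->]]]]]] _ _ hi]].
  run_wp round_body; rewrite addn0.
  split=> // [|v|v]; first by split=> //; do 5 eexists.
    by have [] := hi v isT.
  by rewrite drop_size; have [] := hi v isT.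
apply: (triple_seq (Q := edge_inv g r.+1 0)).
  apply: (@triple_while 16 (edge_inv g r.+1)) => // [k rs h|k].
    by case=> [[_ [x1 [x2 [x3 [x4 [x5 ->]]]]]]].
  exact: edge_triple.
apply: triple_wp => [//|rs h [[lay [x1 [x2 [x3 [x4 [x5 ->]]]]]] _ _ hG]].
run_wp round_body; rewrite subSS subn0.
split; [by exists 0; split=> //; do 5 eexists | exact: ltnW |].
by rewrite -subnSK //; rewrite drop0 in hG.
Qed.

Definition square_inv k : state_pred := fun rs h =>
  [/\ regs ((n - k) * n) k rs h, k <= n & array G (fun=> 0) h].

Lemma square_triple k : triple 16 (square_inv k.+1) square_body 2 (square_inv k).
Proof.
apply: triple_wp => [//|rs h [[lay [x1 [x2 [x3 [x4 [x5 ->]]]]]] kn hG]].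
run_wp square_body; rewrite subSS subn0 -mulSnr subnSK //.
by split=> //; [split=> //; do 5 eexists | exact: ltnW].
Qed.

Lemma main_triple :
  triple 16
    (fun rs h => [/\ rs = mkseq h 16, h 1 = 1, h 2 = B, layout h &
                    forall a, F <= a -> h a = 0])
    main (11 + ((n * 4 + 1) + ((n * n * (n * 13 + m * 37 + 5 + 2) + 1) + 8)))
    (fun rs h => nth 0 rs 0 = (approx A w n (n * n) (vI A) < n)).
Proof.
have s_gt : n + 2 < size s by rewrite /s size_encode; lia.
apply: (triple_seq (Q := square_inv n)).
  apply: triple_wp => [//|rs h [-> h1 h2 lay h0]].
  have hB : h B = n by rewrite -[B]addn0 lay //; lia.
  have hm : h (B + 1 + 1 + n) = m.
    by rewrite -[m](nth_encode_count A w) -/s -lay; [congr h; lia | lia].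
  run_wp main.
  rewrite h1 h2 hB hm addn0; do 2!(split; first by lia).
  split=> //; first by split=> //; rewrite subnn; do 5 eexists.
  (* Memory beyond the copy is still zero, so the array at [G] already holds iterate 0. *)
  by move=> v; rewrite h0 // /F /G; lia.
apply: (triple_seq (Q := square_inv 0)).
  apply: (@triple_while 16 square_inv 10 square_body 2) => // [k rs h|k].
    by case=> [[_ [x1 [x2 [x3 [x4 [x5 ->]]]]]]].
  exact: square_triple.
apply: (triple_seq (Q := round_inv 0)).
  apply: (@triple_conseq 16 (round_inv (n * n)) _ _ _ _ (round_inv 0)) (leqnn _) _ _ => //.
    apply: triple_while => // [r rs h|r]; last exact: round_triple.
    by case=> [[j [_ [x1 [x2 [x3 [x4 [x5 ->]]]]]]]].
  move=> rs h [rg _ hG]; split=> //; first by exists 0; rewrite subn0 in rg.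
  by rewrite subnn.
apply: triple_wp => [//|rs h [[j [lay [x1 [x2 [x3 [x4 [x5 ->]]]]]]] _ hG]].
have hv : h (B + 1) = vI A by rewrite lay //; lia.
run_wp main.
rewrite hv hG subn0; split; first by lia.
split; first by rewrite /G; lia.
by case nE: (n - _) => [|x] /=; [rewrite ltnNge -subn_eq0 nE | rewrite -subn_gt0 nE].
Qed.

End Main.

(** * Step count and assembly *)

Lemma size_edge_list_le n (A : arena n) (w : rweight n) :
  n + size (edge_list A) <= input_size A w.
Proof.
rewrite /input_size leq_add2l -sum1_size; apply: leq_sum => e _.
by case: (w _ _).
Qed.

Theorem theorem4 :
  exists (prog : seq instr) (c d : nat),
    forall (n : nat) (A : arena n) (w : rweight n),
      arena_ok A ->
      exists (t : nat) (m : nat -> nat),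
        t <= c * (input_size A w).+1 ^ d /\
        exec prog t 0 (init_mem (encode A w)) = Some m /\
        (m 0 = 1 <-> exists cap : nat, wins0 A (Recharge w cap)).
Proof.
pose prog := compile 0 (Seq relocate main).
(* Degree 3 comes from [n * n] rounds of linear length; relocation is linear, and 1000 is a generous
   factor. *)
exists prog, 1000, 3 => n A w okA.
pose s := encode A w; pose B := 16 * size s.
have sE : size s = 3 + n + 4 * size (edge_list A) := size_encode A w.
have s_gt0 : 0 < size s by rewrite sE.
have [at1 at2] : placed prog 0 (compile 0 relocate) /\
    placed prog (len relocate) (compile (len relocate) main).
  have := proj1 (placed_cat prog 0 (compile 0 relocate) (compile (len relocate) main)).
  by rewrite size_compile add0n; apply.
have [|t1 [m1 [rs1 [h1 [le1 st1 R1]]]]] :=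
  relocate_triple s_gt0 at1 (m := init_mem s) _ (conj erefl erefl).
  by split=> // a; case: a => [|[|[|[|[|[|]]]]]].
case=> dst [src [x [rsE [srcE dstE] lo _ [_ hi]]]].
have m1h a : 6 <= a -> m1 a = h1 a by case: R1 => _; apply.
(* The register file grows from 6 to 16 cells between the two phases. The copy starts at [B], which
   is at least 16. *)
have [||||t2 [m2 [rs2 [h2 [le2 st2 [R2 _] out]]]]] :=
  @main_triple n A w B _ _ prog _ m1 (mkseq m1 16) m1 at2.
- by rewrite /B; lia.
- by rewrite -/s /B; lia.
- by split=> // a a16; rewrite nth_mkseq.
- have [m1r _] := R1; split=> //; rewrite ?m1r ?rsE //.
    by move=> i; rewrite -/s => lt_i; rewrite m1h /B; [apply: lo; lia | lia].
  by rewrite /B => a le_a; rewrite m1h; [apply: hi; lia | lia].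
(* The extra step is the halt just past the end of the program. *)
exists (t1 + (t2 + 1)), m2; split; last split.
- have := size_edge_list_le A w.
  set I := input_size A w; set k := size (edge_list A) in sE le2 * => le_I.
  have rounds : n * n * (n * 13 + k * 37 + 5 + 2) <= I * I * (37 * I + 7).
    by rewrite !leq_mul //; lia.
  rewrite !expnS expn0; nia.
- have halt : nth IHalt prog (len relocate + len main) = IHalt.
    by rewrite nth_default // size_compile.
  by rewrite st1 st2; cbn [exec]; rewrite halt.
- rewrite R2 // out -(approx_correct w okA).
  by case: (_ < _).
Qed.
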